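(* Let $f:\mathbb{R}^d \to \mathbb{R}^d$ be Lipschitz continuous and $u_0\in \mathbb{R}^d$. Let $(u(t))_{t\ge0}$ be the solution of $u'(t)=f(u(t))$ $(t>0)$, $u(0)=u_0$, and, for $h>0$, let $(V(t),\overline{V}(t))_{t\geq 0}$ be the stochastic Euler dynamics with stepsize parameter $h$ and initial value $u_0$. Moreover, assume access to the jump time process $(\overline{T}(t))_{t \geq 0}$. Then $(V(t))_{t \geq 0} \Rightarrow (u(t))_{t \geq 0}$ as $h \downarrow 0$, i.e. $(V(t))_{t\ge0}$ converges weakly to $(u(t))_{t\ge0}$ in the metric space $(C,d_C)$.
   Context: Let $X=\mathbb{R}^d$ with Euclidean norm $\|\cdot\|$. Stochastic Euler dynamics: for $h>0$ let $H_1,H_2,\ldots$ be i.i.d. exponential random variables with mean $h$ (rate $1/h$) on a probability space $(\Omega,\mathcal{F},\mathbb{P})$, $T_0=0$, $T_k = H_1+\cdots+H_k$. The process $(V(t),\overline{V}(t))_{t\ge0}$ is defined by $V(0)=\overline{V}(0)=u_0$; on each interval between consecutive jump times $T_{k-1},T_k$ $(k\in\mathbb{N})$ it follows $V'(t)=f(\overline{V}(t))$, $\overline{V}'(t)=0$; at each jump time $T_k$ $(k\in\mathbb{N})$, $V(T_k)=V(T_k-)$ and $\overline{V}(T_k)=V(T_k-)$, where $g(t-)$ denotes the left limit. Thus $V$ is continuous and piecewise linear and $\overline{V}$ is piecewise constant. These processes depend on $h$. Jump time process: $(\overline{T}(t))_{t\ge0}$ is the piecewise constant jump process with the same jump times $T_1,T_2,\ldots$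 and $\overline{T}(T_k)=T_k$ $(k\in\mathbb{N}_0)$, i.e. $\overline{T}(t)$ is the last jump time up to $t$. ''Access'' means that it may be observed jointly with $(V,\overline{V})$ (e.g. conditioning on the past may include $\overline{T}$). Path space: $C := C^0([0,\infty);X)$ with metric $$d_C(x,y)=\int_0^\infty e^{-t}\min\Big\{1,\sup_{s\le t}\|x(s)-y(s)\|\Big\}\,\mathrm{d}t .$$ Weak convergence $x_n\Rightarrow x$ of $C$-valued random variables means $\mathbb{E}[F(x_n)]\to\mathbb{E}[F(x)]$ for every bounded continuous $F:C\to\mathbb{R}$; analogously for a family indexed by $h\downarrow0$. *)

(* Defs.v *)
From HB Require Import structures.
From mathcomp Require Import all_boot all_order all_algebra finmap.
From mathcomp Require Import all_classical all_reals all_analysis.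
From mathcomp Require Import measurable_realfun.
From mathcomp Require Import ring lra.

Set Implicit Arguments.
Unset Strict Implicit.
Unset Printing Implicit Defensive.

Import Order.TTheory GRing.Theory Num.Theory.
Import numFieldNormedType.Exports.

Local Open Scope classical_set_scope.
Local Open Scope ring_scope.

(* The library norm on matrices is the sup norm; it induces the same topology
   on R^d, so continuity and derivatives below are the library's. *)
Definition enorm (R : realType) (d : nat) (v : 'rV[R]_d) : R :=
  Num.sqrt (\sum_(i < d) v ord0 i ^+ 2).

Definition lipschitz_enorm (R : realType) (d : nat) (f : 'rV[R]_d -> 'rV[R]_d) :=
  exists L : R, forall x y, enorm (f x - f y) <= L * enorm (x - y).

Section enorm_theory.
Context {R : realType} {d : nat}.
Implicit Types u v : 'rV[R]_d.

Lemma enorm_ge0 v : 0 <= enorm v. Proof. exact: sqrtr_ge0. Qed.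

Lemma sqr_enorm v : enorm v ^+ 2 = \sum_(i < d) v ord0 i ^+ 2.
Proof. by rewrite sqr_sqrtr// sumr_ge0// => i _; exact: sqr_ge0. Qed.

Lemma enormN v : enorm (- v) = enorm v.
Proof. by congr Num.sqrt; apply: eq_bigr => i _; rewrite mxE sqrrN. Qed.

Lemma enorm0 : enorm (0 : 'rV[R]_d) = 0.
Proof. by rewrite /enorm big1 ?sqrtr0// => i _; rewrite mxE expr0n. Qed.

Lemma enorm_eq0 v : enorm v = 0 -> v = 0.
Proof.
move=> v0; have /eqP := sqr_enorm v; rewrite v0 expr0n/= eq_sym.
rewrite psumr_eq0; last by move=> i _; exact: sqr_ge0.
move/allP => h; apply/rowP => i; rewrite mxE; apply/eqP.
by rewrite -sqrf_eq0; apply: (h i); rewrite mem_index_enum.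
Qed.

Lemma dot_le_enorm u v :
  \sum_(i < d) u ord0 i * v ord0 i <= enorm u * enorm v.
Proof.
set s := \sum_(i < d) _.
suff h : s ^+ 2 <= (enorm u * enorm v) ^+ 2.
  have uv0 : 0 <= enorm u * enorm v by rewrite mulr_ge0// enorm_ge0.
  have := ler_norm s; rewrite -sqrtr_sqr => /le_trans; apply.
  by rewrite -(ger0_norm uv0) -sqrtr_sqr ler_sqrt// sqr_ge0.
rewrite exprMn !sqr_enorm.
have : 0 <= \sum_(i < d) \sum_(j < d)
    (u ord0 i * v ord0 j - u ord0 j * v ord0 i) ^+ 2.
  by apply: sumr_ge0 => i _; apply: sumr_ge0 => j _; exact: sqr_ge0.
have -> : \sum_(i < d) \sum_(j < d)
    (u ord0 i * v ord0 j - u ord0 j * v ord0 i) ^+ 2 =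
  (\sum_(i < d) u ord0 i ^+ 2) * (\sum_(i < d) v ord0 i ^+ 2) +
  (\sum_(i < d) v ord0 i ^+ 2) * (\sum_(i < d) u ord0 i ^+ 2) - 2 * (s * s).
  rewrite !big_distrlr/= mulr_sumr -big_split/= -sumrB; apply: eq_bigr => i _.
  rewrite mulr_sumr -big_split/= -sumrB; apply: eq_bigr => j _.
  by ring.
by rewrite expr2 => h; lra.
Qed.

Lemma enormD u v : enorm (u + v) <= enorm u + enorm v.
Proof.
have uv0 : 0 <= enorm u + enorm v by rewrite addr_ge0// enorm_ge0.
rewrite -[leRHS](ger0_norm uv0) -sqrtr_sqr ler_sqrt ?sqr_ge0//.
rewrite sqrrD !sqr_enorm.
have -> : \sum_(i < d) (u + v) ord0 i ^+ 2 = \sum_(i < d) u ord0 i ^+ 2 +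
   (\sum_(i < d) u ord0 i * v ord0 i) *+ 2 + \sum_(i < d) v ord0 i ^+ 2.
  rewrite -sumrMnl -!big_split/=; apply: eq_bigr => i _.
  by rewrite mxE sqrrD.
by rewrite lerD2r lerD2l lerMn2r/= dot_le_enorm.
Qed.

Lemma continuous_enorm : continuous (@enorm R d).
Proof.
move=> v; apply: continuous_comp; last exact: sqrt_continuous.
apply: (@continuous_big _ _ (fun a b : R => a + b) 0 xpredT _ _ _
  (fun i (w : 'rV[R]_d) => w ord0 i ^+ 2)).
  exact: (@add_continuous R).
move=> i _ w; apply: (@continuous_comp _ _ _ (fun w : 'rV[R]_d => w ord0 i)
  (fun a : R => a ^+ 2)); first exact: coord_continuous.
exact: exprn_continuous.
Qed.

End enorm_theory.

(* An element of C^0([0, oo); R^d) is represented by its continuous extension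
   to R that is constant on (-oo, 0]; this is a bijection. *)
Record cpath (R : realType) (d : nat) := CPath {
  cpath_fun :> R -> 'rV[R]_d ;
  cpath_continuous : continuous cpath_fun ;
  cpath_neg : forall t, t <= 0 -> cpath_fun t = cpath_fun 0 }.

Section cpath_metric.
Context {R : realType} {d : nat}.
Notation C := (cpath R d).
Notation mu := (@lebesgue_measure R).
Implicit Types x y z : C.

Lemma cpath_eq x y : (forall t, 0 <= t -> x t = y t) -> x = y.
Proof.
move=> xy; have : x = y :> (R -> 'rV[R]_d).
  apply/funext => t; have [/xy//|/ltW t0] := leP 0 t.
  by rewrite !cpath_neg// xy.
case: x xy => x cx nx; case: y => y cy ny _ /= exy.
subst y; congr CPath; exact: Prop_irrelevance.
Qed.

HB.instance Definition _ := gen_eqMixin (cpath R d).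
HB.instance Definition _ := gen_choiceMixin (cpath R d).

Program Definition cpath_cst (v : 'rV[R]_d) : C := @CPath R d (fun=> v) _ _.
Next Obligation. by move=> v; exact: cst_continuous. Qed.
Next Obligation. by []. Qed.

HB.instance Definition _ := isPointed.Build (cpath R d) (cpath_cst 0).

Definition sup_dist x y (t : R) : R :=
  sup [set enorm (x s - y s) | s in `[0, t]%classic].

Definition cpath_dist x y : R :=
  \int[mu]_(t in `[0, +oo[) (expR (- t) * Num.min 1 (sup_dist x y t)).

Lemma continuous_dist x y : continuous (fun s => enorm (x s - y s)).
Proof.
move=> t; apply: continuous_comp; last exact: continuous_enorm.
by apply: cvgB; exact: cpath_continuous.
Qed.

Lemma sup_dist_neg x y t : t < 0 -> sup_dist x y t = 0.
Proof.
by move=> t0; rewrite /sup_dist set_itv_ge ?image_set0 ?sup0// bnd_simp -ltNge.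
Qed.

Lemma has_sup_dist x y t : 0 <= t ->
  has_sup [set enorm (x s - y s) | s in `[0, t]%classic].
Proof.
move=> t0; split; first by exists (enorm (x 0 - y 0)), 0 => //=; rewrite in_itv/= lexx.
have := @EVT_max R (fun s => enorm (x s - y s)) 0 t t0.
case; first by apply: continuous_subspaceT; exact: continuous_dist.
by move=> c _ h; exists (enorm (x c - y c)) => _ [s /= s0 <-]; apply: h.
Qed.

Lemma sup_dist_ub x y s t : 0 <= s <= t -> enorm (x s - y s) <= sup_dist x y t.
Proof.
move=> /andP[s0 st]; apply: sup_upper_bound.
  by apply: has_sup_dist; exact: le_trans st.
by exists s => //=; rewrite in_itv/= s0.
Qed.

Lemma sup_dist_le x y t M : 0 <= M ->
  (forall s, 0 <= s <= t -> enorm (x s - y s) <= M) -> sup_dist x y t <= M.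
Proof.
move=> M0 h; have [t0|t0] := leP 0 t; last by rewrite sup_dist_neg.
apply: ge_sup => [|_ [s /= s0 <-]]; last by apply: h; rewrite in_itv/= in s0.
by have [] := has_sup_dist x y t0.
Qed.

Lemma sup_dist_ge0 x y t : 0 <= sup_dist x y t.
Proof.
have [t0|t0] := leP 0 t; last by rewrite sup_dist_neg.
by apply: le_trans (enorm_ge0 (x 0 - y 0)) _; apply: sup_dist_ub; rewrite lexx.
Qed.

Lemma sup_dist_nd x y : nondecreasing_fun (sup_dist x y).
Proof.
move=> s t st; apply: sup_dist_le => [|r /andP[r0 rs]]; first exact: sup_dist_ge0.
by apply: sup_dist_ub; rewrite r0 (le_trans rs).
Qed.

Lemma sup_dist_sym x y : sup_dist x y = sup_dist y x.
Proof.
apply/funext => t; congr sup; apply/eq_imagel => s _.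
by rewrite -enormN opprB.
Qed.

Lemma sup_dist_triangle x y z t :
  sup_dist x z t <= sup_dist x y t + sup_dist y z t.
Proof.
apply: sup_dist_le => [|s st]; first by rewrite addr_ge0// sup_dist_ge0.
rewrite -[x s](subrK (y s)) -addrA.
by apply: le_trans (enormD _ _) _; apply: lerD; exact: sup_dist_ub.
Qed.

Let g x y t := expR (- t) * Num.min 1 (sup_dist x y t).

Let g_ge0 x y t : 0 <= g x y t.
Proof. by rewrite /g mulr_ge0 ?expR_ge0// le_min ler01 sup_dist_ge0. Qed.

Let g_integrable x y : mu.-integrable `[0, +oo[%classic (EFin \o g x y).
Proof.
have mT : measurable (`[0, +oo[%classic : set R) by exact: measurable_itv.
apply: (@le_integrable _ _ _ mu _ mT _ (EFin \o exponential_pdf 1)).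
- apply/measurable_EFinP; apply: measurable_funM => /=.
    apply: measurable_funTS; apply: continuous_measurable_fun => t.
    by apply: continuous_comp; [exact: continuousN|exact: continuous_expR].
  apply: measurable_minr => //.
  by apply: nondecreasing_measurable => //; exact: sup_dist_nd.
- move=> t; rewrite /= in_itv/= andbT => t0.
  rewrite lee_fin !ger0_norm ?g_ge0//; last by rewrite exponential_pdf_ge0.
  rewrite exponential_pdfE// mul1r mulN1r.
  by rewrite /g -[leRHS]mulr1 ler_wpM2l ?expR_ge0// ge_min lexx.
- apply: (@integrableS _ _ _ mu setT) => //.
  exact: integrable_exponential_pdf.
Qed.

Lemma cpath_distxx x : cpath_dist x x = 0.
Proof.
rewrite /cpath_dist (_ : (fun _ => _) = cst 0) ?Rintegral_cst ?mul0r//.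
apply/funext => t; rewrite (_ : sup_dist x x t = 0) ?mulr0 /=.
  by rewrite min_r ?mulr0.
apply/eqP; rewrite eq_le sup_dist_ge0 andbT.
by apply: sup_dist_le => // s _; rewrite subrr enorm0.
Qed.

Lemma cpath_dist_sym x y : cpath_dist x y = cpath_dist y x.
Proof. by rewrite /cpath_dist sup_dist_sym. Qed.

Lemma cpath_dist_triangle y x z :
  cpath_dist x z <= cpath_dist x y + cpath_dist y z.
Proof.
rewrite /cpath_dist -RintegralD//; try exact: g_integrable.
apply: le_Rintegral => //; first exact: g_integrable.
  rewrite (_ : EFin \o _ = (EFin \o g x y) \+ (EFin \o g y z))//.
  by apply: integrableD => //; exact: g_integrable.
move=> t _; rewrite -mulrDr ler_wpM2l ?expR_ge0//.
have := sup_dist_triangle x y z t.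
have := sup_dist_ge0 x y t; have := sup_dist_ge0 y z t.
move: (sup_dist x y t) (sup_dist y z t) (sup_dist x z t) => a b c b0 a0 cab.
rewrite /Num.min; case: ifPn; case: ifPn; case: ifPn; rewrite -?leNgt; lra.
Qed.

Lemma cpath_dist_positivity x y : cpath_dist x y = 0 -> x = y.
Proof.
move=> xy0; apply: cpath_eq => t t0.
apply/eqP; rewrite -subr_eq0; apply/eqP/enorm_eq0/eqP.
rewrite eq_le enorm_ge0 andbT leNgt; apply/negP => p.
pose c := expR (- (t + 1)) * Num.min 1 (enorm (x t - y t)).
have c0 : 0 < c by rewrite /c mulr_gt0 ?expR_gt0// lt_min ltr01.
suff : c <= 0 by rewrite leNgt c0.
rewrite -xy0 /cpath_dist.
have -> : c = \int[mu]_(s in `[t, t + 1]) c.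
  rewrite Rintegral_cst// [X in fine X](lebesgue_measure_itv `[t, t + 1]%R) /=.
  by rewrite lte_fin ltrDl ltr01 /= addrAC subrr add0r mulr1.
have -> : `[t, t + 1]%classic = `[0, +oo[%classic `&` `[t, t + 1]%classic :> set R.
  apply/seteqP; split => s /=; rewrite !in_itv/= andbT; last by case.
  by move=> /andP[ts st]; split; [exact: le_trans ts|rewrite ts st].
rewrite Rintegral_mkcondr.
apply: le_Rintegral => //=.
- rewrite (_ : EFin \o _ = (cst c%:E \_ `[t, t + 1]%classic)); last first.
    by apply/funext => s; rewrite /= !patchE; case: ifPn.
  apply/integrable_restrict => //.
  apply: (@integrableS _ _ _ mu `[t, t + 1]%classic) => //.
    exact: measurableI.
  apply/integrableP; split; first exact: measurable_cst.
  rewrite integral_cst//= [X in (_ * X)%E](lebesgue_measure_itv `[t, t + 1]%R)/=.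
  by case: ifPn => _; rewrite -?EFinD -?EFinM ?mule0 ltry.
- exact: g_integrable.
- move=> s _; rewrite patchE; case: ifPn; last by move=> _; exact: g_ge0.
  rewrite inE/= in_itv/= => /andP[ts st].
  rewrite /c; apply: ler_pM; rewrite ?expR_ge0// ?le_min ?ler01 ?enorm_ge0//.
  + by rewrite ler_expR lerN2.
  + rewrite ge_min lexx/= ge_min.
    by rewrite sup_dist_ub ?orbT// t0.
Qed.

HB.instance Definition _ := isMetric.Build R (cpath R d)
  cpath_distxx cpath_dist_positivity cpath_dist_sym cpath_dist_triangle.

End cpath_metric.

Notation borel T := (g_sigma_algebraType (@open T)).

Definition weakly_converges (R : realType) (dO : measure_display)
    (Omega : measurableType dO) (P : probability Omega R)
    (T : ptopologicalType) (X : R -> {RV P >-> borel T})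
    (X0 : {RV P >-> borel T}) : Prop :=
  forall F : T -> R, continuous F -> bounded_fun F ->
    'E_P[F \o X h]%E @[h --> 0^'+] --> 'E_P[F \o X0]%E.

Definition mutually_independent (R : realType) (dO : measure_display)
    (Omega : measurableType dO) (P : probability Omega R)
    (H : nat -> {RV P >-> R}) : Prop :=
  forall (J : {fset nat}) (B : nat -> set R), (forall j, measurable (B j)) ->
    P (\bigcap_(j in [set` J]) (H j @^-1` B j)) =
    (\prod_(j <- J) P (H j @^-1` B j))%E.

(* [H k] is the waiting time H_(k+1). *)
Definition iid_exponential (R : realType) (dO : measure_display)
    (Omega : measurableType dO) (P : probability Omega R)
    (rate : R) (H : nat -> {RV P >-> R}) : Prop :=
  mutually_independent H /\
  forall k (B : set R), measurable B ->
    distribution P (H k) B = exponential_prob rate B.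

Definition jump_time (R : realType) (Omega : Type) (H : nat -> Omega -> R)
    (k : nat) (w : Omega) : R :=
  \sum_(i < k) H i w.

(* Sample paths [v], [vbar] of (V, Vbar) for given jump times [T];
   between jumps both components start at T_k from their values there, whence
   the right limits. *)
Record euler_dynamics (R : realType) (d : nat) (f : 'rV[R]_d -> 'rV[R]_d)
    (u0 : 'rV[R]_d) (T : nat -> R) (v vbar : R -> 'rV[R]_d) : Prop := {
  euler_init : v 0 = u0 /\ vbar 0 = u0 ;
  euler_right : forall k : nat,
    v t @[t --> (T k)^'+] --> v (T k) /\
    vbar t @[t --> (T k)^'+] --> vbar (T k) ;
  euler_flow : forall (k : nat) (t : R), T k < t < T k.+1 ->
    is_derive t 1 v (f (vbar t)) /\ is_derive t 1 vbar 0 ;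
  euler_jump : forall k : nat,
    v t @[t --> (T k.+1)^'-] --> v (T k.+1) /\
    v t @[t --> (T k.+1)^'-] --> vbar (T k.+1) }.

Definition jump_time_path (R : realType) (T : nat -> R) (tbar : R -> R) : Prop :=
  forall (k : nat) (t : R), T k <= t < T k.+1 -> tbar t = T k.

Definition solves_ivp (R : realType) (d : nat) (f : 'rV[R]_d -> 'rV[R]_d)
    (u0 : 'rV[R]_d) (u : cpath R d) : Prop :=
  u 0 = u0 /\ forall t : R, 0 < t -> is_derive t 1 u (f (u t)).

(* Main.v *)
Require Import Defs.
From HB Require Import structures.
From mathcomp Require Import all_boot all_order all_algebra finmap.
From mathcomp Require Import all_classical all_reals all_analysis.
From mathcomp Require Import measurable_realfun.
From mathcomp Require Import ring lra.

Set Implicit Arguments.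
Unset Strict Implicit.
Unset Printing Implicit Defensive.

Import Order.TTheory GRing.Theory Num.Theory.
Import numFieldNormedType.Exports.

Local Open Scope classical_set_scope.
Local Open Scope ring_scope.

(** Each sample path of V is an Euler polygon for u' = f(u) with step sizes
    H_1, H_2, ..., so the probabilistic content reduces to a statement about
    the jump times: for h small, with probability close to 1, the jump times
    leave no gap longer than a given delta before they have passed a given
    time tau. On that event the classical error analysis of the explicit Euler
    scheme ([euler_error]) gives |V - u| <= K delta exp(L tau) on [0, tau], where
    L is a Lipschitz constant of f and K bounds |f(u)| on [0, tau]. The weight
    exp(-t) in the metric makes the contribution of times after tau uniformly
    small ([cpath_dist_le]). Hence V converges to the deterministic path u in
    probability, and for a deterministic limit this is weak convergence
    ([weakly_converges_cst]).

    The jump times are controlled by union bounds only, without a law of large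
    numbers. Take m of order tau / h and look at the first m * m gaps, cut into
    m blocks of m consecutive gaps. Some gap exceeds delta with probability at
    most m^2 exp(-delta / h). Some block has all its gaps at most h with
    probability at most m (1 - exp(-1))^m; this is where independence enters.
    Outside these two events ([irregular], [prob_irregular]) every block lasts
    longer than h, so the m * m jumps reach time m h >= tau. Both bounds are
    O(h) ([irregular_bound_le]). *)

(** * Euler polygons *)

Section pathwise.
Context {R : realType} {d : nat}.
Implicit Types (g dg v vbar : R -> 'rV[R]_d) (f : 'rV[R]_d -> 'rV[R]_d).

Lemma is_derive_coord g (x : R) (l : 'rV[R]_d) (i : 'I_d) :
  is_derive x 1 g l -> is_derive x 1 (fun t => g t ord0 i) (l ord0 i).
Proof.
move=> [dg gl]; have dgi := (derivable_mxP _ _ _).1 dg ord0 i.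
by apply: DeriveDef => //; rewrite -gl derive_mx// mxE.
Qed.

(** The mean value theorem fails for vector-valued maps, but applying the scalar
    one to the inner product of g with the increment w = g b - g a gives
    |w|^2 = <dg c, w> (b - a) for some c, and Cauchy-Schwarz concludes. *)
Lemma enorm_mean_value g dg (a b M : R) : a <= b ->
  (forall t, a < t < b -> is_derive t 1 g (dg t)) ->
  (forall t, a < t < b -> enorm (dg t) <= M) ->
  {in `[a, b], continuous g} ->
  enorm (g b - g a) <= M * (b - a).
Proof.
rewrite le_eqVlt => /predU1P[<- _ _ _|ab gdg dgM cg].
  by rewrite !subrr mulr0 enorm0.
pose w := g b - g a.
pose phi := \sum_(i < d) (fun t => g t ord0 i * w ord0 i).
pose dphi t := \sum_(i < d) (dg t ord0 i * w ord0 i).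
have phiE t : phi t = \sum_(i < d) g t ord0 i * w ord0 i by rewrite /phi fct_sumE.
have [||c cab] := @MVT R phi dphi a b ab.
- move=> t tab; apply: is_derive_sum => i.
  have /(is_derive_coord i) dgi : is_derive t 1 g (dg t).
    by apply: gdg; rewrite in_itv in tab.
  have -> : (fun t => g t ord0 i * w ord0 i) = (w ord0 i) \*: (fun t => g t ord0 i).
    by apply/funext => s /=; rewrite mulrC.
  rewrite mulrC; exact: is_deriveZ.
- apply: continuous_in_subspaceT => t; rewrite inE/= => /cg gt.
  rewrite (_ : phi = (fun y : 'rV[R]_d => \sum_(i < d) y ord0 i * w ord0 i) \o g).
    apply: continuous_comp => //.
    apply: (@continuous_big _ _ (fun a b : R => a + b) 0 xpredT _ _ _
      (fun i (y : 'rV[R]_d) => y ord0 i * w ord0 i)).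
      exact: (@add_continuous R).
    move=> i _ y; apply: (@continuous_comp _ _ _ (fun y : 'rV[R]_d => y ord0 i)
      (fun a : R => a * w ord0 i)); first exact: coord_continuous.
    exact: mulrr_continuous.
  by apply/funext => s; rewrite phiE.
have -> : phi b - phi a = enorm w ^+ 2.
  rewrite sqr_enorm !phiE -sumrB; apply: eq_bigr => i _.
  by rewrite -mulrBl !mxE expr2.
move=> e; have := dot_le_enorm (dg c) w; rewrite -/(dphi c).
have {}dgM : enorm (dg c) <= M by apply: dgM; rewrite in_itv in cab.
have := enorm_ge0 w; rewrite le_eqVlt => /predU1P[w0 _|w0 dphiM].
  by rewrite -/w -w0 mulr_ge0 ?subr_ge0 ?(ltW ab)// (le_trans (enorm_ge0 _) dgM).
rewrite -/w -(ler_pM2r w0) -expr2 e mulrAC ler_wpM2r ?subr_ge0 ?(ltW ab)//.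
by apply: le_trans dphiM _; rewrite ler_wpM2r// ltW.
Qed.

Variables (f : 'rV[R]_d -> 'rV[R]_d) (u0 : 'rV[R]_d) (T : nat -> R).
Variables (v vbar : R -> 'rV[R]_d).
Hypothesis T0 : T 0%N = 0.
Hypothesis vE : euler_dynamics f u0 T v vbar.

Lemma euler_vbar_jump k : vbar (T k) = v (T k).
Proof.
case: vE => -[v0 vbar0] _ _ jump; case: k => [|k]; first by rewrite T0 v0.
by have [+ +] := jump k => /cvg_unique h /h ->.
Qed.

(** Right after T_k the frozen component has zero derivative, hence is constant
    on the open interval; right continuity identifies the constant. *)
Lemma euler_vbar_cst k t : T k < t < T k.+1 -> vbar t = v (T k).
Proof.
case: vE => _ right flow _ /andP[Tkt tTk].
have vbar_cst : \forall s \near (T k)^'+, vbar s = vbar t.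
  near=> s.
  have Tks : T k < s by near: s; exact: nbhs_right_gt.
  have st : s <= t by near: s; exact: nbhs_right_le.
  have hs r : s <= r <= t -> T k < r < T k.+1.
    by move=> /andP[sr rt]; rewrite (lt_le_trans Tks sr) (le_lt_trans rt tTk).
  have : enorm (vbar t - vbar s) <= 0 * (t - s).
    apply: (@enorm_mean_value vbar (fun=> 0)) => //.
    - by move=> r /andP[sr rt]; have [] := flow k r (hs _ _); rewrite ?ltW.
    - by move=> r _; rewrite enorm0.
    - move=> r; rewrite in_itv/= => rst.
      have [_ [dr _]] := flow k r (hs _ rst).
      exact/differentiable_continuous/derivable1_diffP.
  rewrite mul0r => e0; apply/eqP; rewrite eq_sym -subr_eq0; apply/eqP/enorm_eq0.
  by apply/eqP; rewrite eq_le enorm_ge0 e0.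
have [_ vbarT] := right k.
have vbart : vbar s @[s --> (T k)^'+] --> vbar t.
  by apply: cvg_near_cst; apply: filterS vbar_cst => s ->.
by rewrite -euler_vbar_jump; exact: cvg_unique vbart vbarT.
Unshelve. all: by end_near. Qed.

(** On each step the derivatives of v and u differ by at most
    L (|v - u|(T_k) + K delta), because u moves by at most K delta during the
    step. So |v - u| + K delta grows over the step at most by the factor
    1 + L (t - T_k) <= exp(L (t - T_k)), and these factors multiply up; adding
    the constant K delta to the error is what makes the recursion geometric. *)
Lemma euler_error (u : R -> 'rV[R]_d) (L K delta tau : R) (N : nat) :
  continuous v -> continuous u ->
  u 0 = u0 -> (forall t : R, 0 < t -> is_derive t 1 u (f (u t))) ->
  0 <= L -> (forall x y, enorm (f x - f y) <= L * enorm (x - y)) ->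
  (forall t : R, 0 <= t <= tau -> enorm (f (u t)) <= K) -> 0 <= K ->
  (forall k, (k < N)%N -> 0 <= T k.+1 - T k <= delta) ->
  forall k, (k <= N)%N -> forall t : R, 0 <= t <= T k -> t <= tau ->
  enorm (v t - u t) + K * delta <= K * delta * expR (L * t).
Proof.
move=> cv cu uu0 du L0 lf fK K0 gap; elim => [_ t|k IH kN t /andP[t0 tTk] ttau].
  rewrite T0 -eq_le => /eqP <- _; rewrite uu0.
  by case: vE => -[-> _] _ _ _; rewrite subrr enorm0 mulr0 expR0 mulr1 add0r.
have [tTk'|Tkt] := leP t (T k); first by apply: IH => //; [exact: ltnW|apply/andP].
have /andP[gap0 gapd] := gap _ kN.
have Tk0 : 0 <= T k.
  elim: {IH tTk Tkt gap0 gapd} k kN => [|k IH] kN; first by rewrite T0.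
  by have := IH (ltnW kN); have := gap k (ltnW kN); lra.
have IHk : enorm (v (T k) - u (T k)) + K * delta <= K * delta * expR (L * T k).
  by apply: IH; rewrite ?(ltnW kN) ?Tk0 ?lexx// (le_trans (ltW Tkt)).
set E := enorm (v (T k) - u (T k)) in IHk.
have uK r : T k < r < t -> enorm (u r - u (T k)) <= K * delta.
  move=> /andP[Tkr rt]; apply: (@le_trans _ _ (K * (r - T k))).
    apply: (@enorm_mean_value u (fun t => f (u t))).
    - exact: ltW.
    - by move=> s /andP[Tks sr]; apply: du; exact: le_lt_trans Tks.
    - move=> s /andP[Tks sr]; apply: fK.
      rewrite (le_trans Tk0 (ltW Tks))/=.
      by rewrite (le_trans (ltW sr))// (le_trans (ltW rt)).
    - by move=> s _; exact: cu.
  by rewrite ler_wpM2l//; lra.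
have step : enorm ((v t - u t) - (v (T k) - u (T k))) <=
    L * (E + K * delta) * (t - T k).
  apply: (@enorm_mean_value (v \- u) (fun t => f (vbar t) - f (u t))).
  - exact: ltW.
  - move=> r /andP[Tkr rt]; apply: is_deriveB.
      case: vE => _ _ flow _.
      by have [] := flow k r; rewrite ?Tkr ?(lt_le_trans rt).
    by apply: du; exact: le_lt_trans Tkr.
  - move=> r Tkrt; have /andP[Tkr rt] := Tkrt.
    apply: le_trans (lf _ _) _; rewrite ler_wpM2l//.
    rewrite (@euler_vbar_cst k) ?Tkr ?(lt_le_trans rt)//.
    rewrite -(subrK (u (T k)) (v (T k))) -addrA.
    apply: le_trans (enormD _ _) _; rewrite lerD2l.
    by rewrite -enormN opprB uK.
  - by move=> r _; apply: cvgB; [exact: cv|exact: cu].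
have tri : enorm (v t - u t) <= E + L * (E + K * delta) * (t - T k).
  rewrite -[v t - u t](subrK (v (T k) - u (T k))) addrC.
  by apply: le_trans (enormD _ _) _; rewrite lerD2l.
apply: (@le_trans _ _ ((E + K * delta) * (1 + L * (t - T k)))).
  apply: le_trans (lerD tri (lexx (K * delta))) _.
  by rewrite le_eqVlt; apply/orP; left; apply/eqP; ring.
have -> : expR (L * t) = expR (L * T k) * expR (L * (t - T k)).
  by rewrite -expRD; congr expR; ring.
rewrite mulrA; apply: ler_pM => //.
- by rewrite addr_ge0 ?enorm_ge0 ?mulr_ge0//; lra.
- by rewrite addr_ge0// mulr_ge0// subr_ge0 ltW.
- exact: expR_ge1Dx.
Qed.

End pathwise.

(** * The path metric *)

(** Before tau the integrand is at most eta exp(-t); after tau it is at most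
    exp(-t) <= exp(-tau/2) exp(-t/2). The sum of the two bounds holds for all t
    and is a combination of the exponential densities of rates 1 and 1/2, whose
    integrals are 1; this avoids splitting the integral at tau. *)
Lemma cpath_dist_le (R : realType) (d : nat) (x y : cpath R d) (tau eta : R) :
  sup_dist x y tau <= eta -> cpath_dist x y <= eta + 2 * expR (- (tau / 2)).
Proof.
move=> xyeta; have eta0 : 0 <= eta by exact: le_trans (sup_dist_ge0 _ _ _) xyeta.
set c := 2 * expR _; have c0 : 0 <= c by rewrite mulr_ge0 ?expR_ge0.
pose mu := @lebesgue_measure R.
have mT : measurable (`[0, +oo[%classic : set R) by exact: measurable_itv.
have pdf_ge0 (r t : R) : (0 < r)%R -> (0 <= (exponential_pdf r t)%:E)%E.
  by move=> r0; rewrite lee_fin exponential_pdf_ge0// ltW.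
have mpdf r D : measurable_fun D (fun t : R => (exponential_pdf r t)%:E).
  apply/measurable_EFinP; apply: measurable_funTS.
  exact: measurable_exponential_pdf.
rewrite /cpath_dist /Rintegral.
set I := integral _ _ _.
suff : (0 <= I <= (eta + c)%:E)%E.
  move=> /andP[I0 Ic]; have If : (I \is a fin_num)%E.
    by rewrite ge0_fin_numE// (le_lt_trans Ic) ?ltry.
  by rewrite -lee_fin fineK.
apply/andP; split.
  apply: integral_ge0 => t _.
  by rewrite lee_fin mulr_ge0 ?expR_ge0// le_min ler01 sup_dist_ge0.
apply: (@le_trans _ _ (\int[mu]_(t in `[0%R, +oo[)
   (eta%:E * (exponential_pdf 1 t)%:E + c%:E * (exponential_pdf (2^-1) t)%:E))%E).
  apply: ge0_le_integral => //.
  - move=> t _.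
    by rewrite lee_fin mulr_ge0 ?expR_ge0// le_min ler01 sup_dist_ge0.
  - apply/measurable_EFinP; apply: measurable_funM => /=.
      apply: measurable_funTS; apply: continuous_measurable_fun => t.
      by apply: continuous_comp; [exact: continuousN|exact: continuous_expR].
    apply: measurable_minr => //.
    by apply: nondecreasing_measurable => //; exact: sup_dist_nd.
  - apply: emeasurable_funD; apply: emeasurable_funM => //; exact: mpdf.
  - move=> t; rewrite /= in_itv/= andbT => t0.
    rewrite lee_fin !exponential_pdfE// mul1r mulN1r.
    have e0 : 0 <= expR (- t) by exact: expR_ge0.
    have [ttau|/ltW taut] := leP t tau.
      rewrite -[leLHS]addr0; apply: lerD; last by rewrite !mulr_ge0 ?expR_ge0.
      rewrite mulrC ler_wpM2r// ge_min; apply/orP; right; apply: le_trans xyeta.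
      exact: sup_dist_nd.
    rewrite -[leLHS]add0r; apply: lerD; first by rewrite mulr_ge0.
    apply: (@le_trans _ _ (expR (- t) * 1)).
      by rewrite ler_wpM2l// ge_min lexx.
    have -> : expR (- t) = expR (- (t / 2)) * expR (- (2^-1) * t).
      by rewrite -expRD; congr expR; lra.
    rewrite mulr1.
    rewrite [leRHS](_ : _ = expR (- (tau / 2)) * expR (- 2^-1 * t)); last first.
      by rewrite /c; field.
    by rewrite ler_wpM2r ?expR_ge0// ler_expR; lra.
apply: (@le_trans _ _ (\int[mu]_t
   (eta%:E * (exponential_pdf 1 t)%:E + c%:E * (exponential_pdf (2^-1) t)%:E))%E).
  apply: ge0_subset_integral => //.
  - by apply: emeasurable_funD; apply: emeasurable_funM => //; exact: mpdf.
  - by move=> t _; rewrite adde_ge0// mule_ge0// ?lee_fin// -lee_fin pdf_ge0.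
rewrite ge0_integralD//=; last 4 first.
  by move=> t _; rewrite mule_ge0// ?lee_fin// -lee_fin pdf_ge0.
  by apply: emeasurable_funM => //; exact: mpdf.
  by move=> t _; rewrite mule_ge0// ?lee_fin// -lee_fin pdf_ge0.
  by apply: emeasurable_funM => //; exact: mpdf.
rewrite !ge0_integralZl_EFin//; do ?[exact: mpdf|by move=> t _; exact: pdf_ge0].
by rewrite !integral_exponential_pdf// !mule1 EFinD.
Qed.

(** * Regularity of the jump times *)

Section exponential_gaps.
Context {R : realType} {dO : measure_display} {Omega : measurableType dO}.
Context {P : probability Omega R} (h : R) (H : nat -> {RV P >-> R}).
Hypothesis iidH : iid_exponential h^-1 H.

(** The lower bound 0 makes the complement of this event include the null event
    of a negative gap, so that regular jump times are automatically monotone. *)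
Definition gap_le (k : nat) (a : R) : set Omega := H k @^-1` `[0, a]%classic.

Lemma measurable_gap_le k a : measurable (gap_le k a).
Proof.
by apply: measurable_funPTI.
Qed.

Lemma prob_gap_le k a : 0 < a -> P (gap_le k a) = (1 - expR (- (a / h)))%:E.
Proof.
move=> a0; have [_ dH] := iidH.
rewrite -[P _]/(distribution P (H k) `[0, a]%classic) dH//.
by rewrite exponential_prob_itv0c// EFinB mulNr mulrC.
Qed.

Lemma prob_gap_gt k a : 0 < a -> P (~` gap_le k a) = (expR (- (a / h)))%:E.
Proof.
move=> a0; rewrite probability_setC; last exact: measurable_gap_le.
by rewrite prob_gap_le// -EFinB subKr.
Qed.

Definition short_block (a : R) (i m : nat) : set Omega :=
  \bigcap_(k in [set` [fset k in iota i m]%fset]) gap_le k a.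

Lemma measurable_short_block a i m : measurable (short_block a i m).
Proof. by apply: fin_bigcap_measurable => // k _; exact: measurable_gap_le. Qed.

Lemma prob_short_block a i m : 0 < a ->
  P (short_block a i m) = ((1 - expR (- (a / h))) ^+ m)%:E.
Proof.
move=> a0; have [indep _] := iidH.
rewrite [P _](indep _ (fun=> `[0, a]%classic))//.
under eq_bigr do rewrite [P _]prob_gap_le//.
rewrite prodEFin big_const_seq count_predT iter_mulr_1.
by rewrite card_fseq undup_id ?iota_uniq// size_iota.
Qed.

(** Blocks replace a law of large numbers: a block fails to last longer than b
    only if all its m independent gaps are at most b, which has probability
    exponentially small in m, so that a union bound over m blocks suffices. *)
Definition irregular (a b : R) (m : nat) : set Omega :=
  (\big[setU/set0]_(k < m * m) ~` gap_le k a) `|`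
  (\big[setU/set0]_(j < m) short_block b (j * m) m).

Lemma measurable_irregular a b m : measurable (irregular a b m).
Proof.
apply: measurableU; apply: bigsetU_measurable => k _.
  exact/measurableC/measurable_gap_le.
exact: measurable_short_block.
Qed.

Lemma prob_irregular a b m : 0 < a -> 0 < b ->
  (P (irregular a b m) <= ((m * m)%:R * expR (- (a / h)) +
                          m%:R * (1 - expR (- (b / h))) ^+ m)%:E)%E.
Proof.
move=> a0 b0.
apply: le_trans (measureU2 _ _ _) _.
- apply: bigsetU_measurable => k _; exact/measurableC/measurable_gap_le.
- by apply: bigsetU_measurable => k _; exact: measurable_short_block.
rewrite EFinD; apply: leeD.
- apply: le_trans (@Boole_inequality _ _ _ P (fun k => ~` gap_le k a) _ _) _.
    by move=> k _; exact/measurableC/measurable_gap_le.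
  under eq_bigr => k _ do rewrite /= prob_gap_gt//.
  by rewrite sumEFin sumr_const card_ord mulr_natl.
- apply: le_trans
    (@Boole_inequality _ _ _ P (fun j => short_block b (j * m) m) _ _) _.
    by move=> k _; exact: measurable_short_block.
  under eq_bigr => k _ do rewrite /= prob_short_block//.
  by rewrite sumEFin sumr_const card_ord mulr_natl.
Qed.

Lemma regular_gap a b m w k : ~ irregular a b m w -> (k < m * m)%N ->
  0 <= H k w <= a.
Proof.
move=> reg kmm; apply/negP => nH; apply: reg; left.
rewrite -(bigcup_mkord _ (fun k => ~` gap_le k a)); by exists k.
Qed.

(** Each of the m blocks contains a gap longer than b and no negative gap, so it
    adds at least b to the jump time. *)
Lemma regular_jump_time a b m w : 0 <= b -> ~ irregular a b m w ->
  m%:R * b <= jump_time H (m * m)%N w.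
Proof.
move=> b0 reg.
have H0 k : (k < m * m)%N -> 0 <= H k w by move=> /(regular_gap reg)/andP[].
suff blocks : forall j, (j <= m)%N -> j%:R * b <= jump_time H (j * m)%N w.
  exact: blocks.
elim => [_|j IH jm]; first by rewrite mul0r mul0n /jump_time big_ord0.
have {IH} := IH (ltnW jm).
rewrite -natr1 mulrDl mul1r mulSn addnC /jump_time big_split_ord/= => IH.
apply: lerD => //.
have jmm i : (i < m)%N -> (j * m + i < m * m)%N.
  move=> im; apply: (@leq_trans (j.+1 * m)); last by rewrite leq_mul2r jm orbT.
  by rewrite mulSn addnC ltn_add2r.
have [i im Hi] : exists2 i, (i < m)%N & b < H (j * m + i)%N w.
  apply: contrapT => short; apply: reg; right.
  rewrite -(bigcup_mkord _ (fun j => short_block b (j * m) m)); exists j => //= k.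
  rewrite /= inE mem_iota => /andP[jk km].
  have km' : (k - j * m < m)%N by rewrite ltn_subLR.
  have := H0 _ (jmm _ km'); rewrite subnKC// => Hk.
  rewrite /gap_le/= in_itv/= Hk/= leNgt; apply/negP => bH; apply: short.
  by exists (k - j * m)%N => //; rewrite subnKC.
rewrite (bigD1 (Ordinal im))//= -[leLHS]addr0 lerD// ?(ltW Hi)//.
by apply: sumr_ge0 => l _; apply: H0; exact: jmm.
Qed.

End exponential_gaps.
Lemma expRN_le (R : realType) (x : R) (n : nat) : 0 < x ->
  expR (- x) <= n.+1`!%:R / x ^+ n.+1.
Proof.
move=> x0; have x_ge0 := ltW x0.
rewrite expRN -[leRHS]invrK lef_pV2 ?posrE ?expR_gt0
  ?invr_gt0 ?divr_gt0 ?exprn_gt0//.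
rewrite invf_div; apply: le_trans (expR_ge1Dxn n x_ge0).
by rewrite lerDr.
Qed.

(** Since m h stays within [tau, tau + 1], the estimate exp(-x) <= 6 / x^3 at
    x = a / h turns the first term into a multiple of (m h)^2 h. For the second,
    (1 - c)^m <= exp(- m c) <= 2 / (m c)^2 with c = exp(-1) leaves a multiple of
    1 / m <= h / tau. *)
Lemma irregular_bound_le (R : realType) (tau a h : R) :
  0 < tau -> 0 < a -> 0 < h <= 1 ->
  let m := (Num.truncn (tau / h)).+1 in
  (m * m)%:R * expR (- (a / h)) + m%:R * (1 - expR (- (h / h))) ^+ m <=
  (6 * (tau + 1) ^+ 2 / a ^+ 3 + 2 / (tau * expR (- 1) ^+ 2)) * h.
Proof.
move=> tau0 a0 /andP[h0 h1] /=; set m := (Num.truncn _).+1.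
have tauh0 : 0 <= tau / h by rewrite divr_ge0 ?ltW.
have mh : tau <= m%:R * h.
  by rewrite -ler_pdivrMr// ltW// truncnS_gt.
have mh' : m%:R * h <= tau + 1.
  have : m%:R <= tau / h + 1 by rewrite -natr1 lerD2r truncn_le.
  by rewrite -(ler_pM2r h0) mulrDl mul1r divfK ?gt_eqF//; lra.
rewrite mulrDl; apply: lerD.
  apply: (@le_trans _ _ ((m * m)%:R * (6 / (a / h) ^+ 3))).
    by rewrite ler_wpM2l//; apply: (@expRN_le _ _ 2); rewrite divr_gt0.
  have -> : (m * m)%:R * (6 / (a / h) ^+ 3) = 6 * (m%:R * h) ^+ 2 / a ^+ 3 * h.
    by rewrite natrM; field; rewrite !gt_eqF.
  rewrite ler_wpM2r ?(ltW h0)// ler_wpM2r ?invr_ge0 ?exprn_ge0 ?(ltW a0)//.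
  rewrite ler_wpM2l// ler_sqr ?nnegrE//; first by rewrite mulr_ge0 ?(ltW h0).
  by rewrite addr_ge0 ?ltW.
rewrite divff ?gt_eqF//; set c := expR (- 1); have c0 : 0 < c by exact: expR_gt0.
have m0 : 0 < m%:R :> R by rewrite ltr0n.
have mc0 : 0 < m%:R * c by rewrite mulr_gt0.
apply: (@le_trans _ _ (m%:R * (2 / (m%:R * c) ^+ 2))).
  rewrite ler_wpM2l// (le_trans _ (@expRN_le _ _ 1 mc0))//.
  rewrite -mulrN mulrC expRM_natr; apply: lerXn2r.
  - by rewrite nnegrE subr_ge0 -[leRHS]expR0 ler_expR; lra.
  - by rewrite nnegrE expR_ge0.
  - exact: expR_ge1Dx.
have -> : m%:R * (2 / (m%:R * c) ^+ 2) = 2 * c ^- 2 * m%:R^-1.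
  by field; rewrite !gt_eqF.
have -> : 2 / (tau * c ^+ 2) * h = 2 * c ^- 2 * (h / tau).
  by field; rewrite !gt_eqF.
rewrite ler_wpM2l//.
  by rewrite mulr_ge0// invr_ge0 exprn_ge0// ltW.
by rewrite ler_pdivlMr// mulrC ler_pdivrMr// mulrC.
Qed.

(** * Weak convergence to a constant *)

Lemma borel_measurable_continuous (R : realType) (T : ptopologicalType)
    (F : T -> R) :
  continuous F -> measurable_fun [set: borel T] (F : borel T -> R).
Proof.
move=> cF mT; apply: (measurability _ (RGenOpens.measurableE R)) => //.
move=> _ [_ [a [b ->]] <-]; rewrite setTI; apply: sub_sigma_algebra.
by move/continuousP : cF; apply; exact: itv_open.
Qed.

(** Convergence in probability to a point implies weak convergence: for F
    bounded by M, the difference F x0 - F X is at most e / 2 in absolute value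
    outside a small event B, and at most 2 M on B. Off B the closeness is
    required only almost surely, because random variables such as these paths
    are described only up to a null event. *)
Lemma weakly_converges_cst (R : realType) (dO : measure_display)
    (Omega : measurableType dO) (P : probability Omega R)
    (T : ptopologicalType) (X : R -> {RV P >-> borel T}) (x0 : T) :
  (forall U : set T, nbhs x0 U -> forall eta : R, 0 < eta ->
    \forall h \near 0^'+, exists B, [/\ measurable B, (P B <= eta%:E)%E &
      {ae P, forall w, ~ B w -> U (X h w)}]) ->
  weakly_converges X (cst x0 : {RV P >-> borel T}).
Proof.
move=> XU F cF [M0 [_ FM0]].
have [M M_gt0 FM] : exists2 M : R, 0 < M & forall x, `|F x| <= M.
  exists (`|M0| + 1); first by rewrite ltr_wpDl.
  by move=> x; apply: FM0 => //; rewrite ltr_pwDr// ler_norm.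
have mFX h : measurable_fun setT (F \o X h).
  by apply: measurableT_comp => //; exact: borel_measurable_continuous.
have iFX h : P.-integrable setT (EFin \o (F \o X h)).
  apply: (@measurable_bounded_integrable _ _ _ P) => //.
    by rewrite [ltLHS]probability_setT ltry.
  exists M; split; first exact: num_real.
  by move=> M' MM' w _; rewrite /= (le_trans (FM _))// ltW.
have -> : 'E_P[F \o (cst x0 : {RV P >-> borel T})]%E = (F x0)%:E.
  have -> : F \o (cst x0 : {RV P >-> borel T}) = cst (F x0) by exact/funext.
  exact: (expectation_cst P).
have EfX h : ('E_P[F \o X h] = (fine 'E_P[F \o X h])%:E)%E.
  by rewrite fineK// expectation_fin_num//; exact/Lfun1_integrable.
under eq_cvg do rewrite EfX.
apply: cvg_EFin; first exact: nearW.
apply/cvgrPdist_le => e e0.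
have U : nbhs x0 [set x | `|F x0 - F x| < e / 2].
  by move/cvgrPdist_lt : (cF x0); apply; rewrite divr_gt0.
have eta0 : 0 < e / 2 / (2 * M) by rewrite !divr_gt0// mulr_gt0.
near=> h.
have [B [mB PB BU]] : exists B, [/\ measurable B, (P B <= (e / 2 / (2 * M))%:E)%E &
    {ae P, forall w, ~ B w -> `|F x0 - F (X h w)| < e / 2}].
  near: h; exact: (XU _ U _ eta0).
pose Z := cst (F x0) \- (F \o X h).
have iF0 : P.-integrable setT (EFin \o cst (F x0)).
  exact: finite_measure_integrable_cst.
have mZ : measurable_fun setT Z by exact: measurable_funB.
have EZ : ('E_P[Z] = (F x0 - fine ('E_P[F \o X h])%E)%:E)%E.
  rewrite expectationB; [|exact/Lfun1_integrable..].
  by rewrite expectation_cst EFinB -EfX.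
rewrite -lee_fin -[leLHS]/(`|(F x0 - fine ('E_P[F \o X h])%E)%:E|)%E -EZ.
have le1 : (`|'E_P[Z]| <= 'E_P[fun w => (`|Z w|)%R])%E.
  rewrite unlock; apply: le_abse_integral => //; exact/measurable_EFinP.
apply: (le_trans le1).
pose Y w := e / 2 + 2 * M * \1_B w.
apply: (@le_trans _ _ 'E_P[Y]%E).
  apply: expectation_le => //.
  - exact: measurableT_comp.
  - apply: measurable_funD => //; apply: measurable_funM => //.
  - by move=> w; rewrite /Y addr_ge0 ?mulr_ge0// ?divr_ge0// ltW.
  - apply: filterS BU => w BU; rewrite /Y indicE /=.
    have [Bw|nBw] := pselect (B w).
      rewrite mem_set// mulr1 (le_trans (ler_normB _ _))//.
      rewrite -[leLHS]add0r lerD// ?divr_ge0 ?(ltW e0)//.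
      by have := FM x0; have := FM (X h w); rewrite /=; lra.
    by rewrite memNset// mulr0 addr0 ltW// BU.
have -> : 'E_P[Y]%E = ((e / 2)%:E + (2 * M)%:E * P B)%E.
  rewrite unlock /Y; under eq_integral do rewrite EFinD (EFinM (2 * M)).
  have mB' : measurable_fun setT (fun w => (\1_B w : R)%:E).
    exact/measurable_EFinP.
  rewrite ge0_integralD//.
  - rewrite integral_cst// [X in (_ * X)%E]probability_setT mule1.
        rewrite ge0_integralZl_EFin//; last by rewrite mulr_ge0// ltW.
    by rewrite integral_indic// setIT.
  - by move=> w _; rewrite lee_fin divr_ge0// ltW.
  - by move=> w _; rewrite lee_fin mulr_ge0// mulr_ge0// ltW.
  - exact: emeasurable_funM.
apply: (@le_trans _ _ ((e / 2)%:E + (2 * M)%:E * (e / 2 / (2 * M))%:E)%E).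
  by rewrite leeD2l// lee_pmul2l// lte_fin mulr_gt0.
rewrite -EFinM -EFinD lee_fin [X in _ + X]mulrC divfK ?gt_eqF ?mulr_gt0//.
by rewrite -splitr.
Unshelve. all: by end_near. Qed.
(** * The stochastic Euler dynamics *)

Theorem theorem3p4 (R : realType) (d : nat)
    (f : 'rV[R]_d -> 'rV[R]_d) (hf : lipschitz_enorm f)
    (u0 : 'rV[R]_d) (u : cpath R d) (hu : solves_ivp f u0 u)
    (dO : measure_display) (Omega : measurableType dO)
    (P : probability Omega R)
    (H : R -> nat -> {RV P >-> R})
    (hH : forall h : R, 0 < h -> iid_exponential h^-1 (H h))
    (V : R -> {RV P >-> borel (cpath R d)})
    (Vbar : R -> R -> Omega -> 'rV[R]_d)
    (hV : forall h : R, 0 < h ->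
      {ae P, forall w, euler_dynamics f u0 (fun k => jump_time (H h) k w)
                         (V h w : cpath R d) (fun t => Vbar h t w)})
    (Tbar : R -> R -> Omega -> R)
    (hT : forall h : R, 0 < h ->
      {ae P, forall w, jump_time_path (fun k => jump_time (H h) k w)
                         (fun t => Tbar h t w)}) :
  weakly_converges V (cst u).
Proof.
apply: weakly_converges_cst => U /nbhs_ballP[e /= e0 eU] eta eta0.
have [L0 fL0] := hf; pose L := `|L0|.
have L_ge0 : 0 <= L by exact: normr_ge0.
have fL x y : enorm (f x - f y) <= L * enorm (x - y).
  by rewrite (le_trans (fL0 x y))// ler_wpM2r ?enorm_ge0// ler_norm.
(* The horizon beyond which all paths contribute less than e / 2; the value
   comes from exp(-x) <= 1 / x at x = tau / 2. *)
have [tau tau0 etau] : exists2 tau : R, 0 < tau & 2 * expR (- (tau / 2)) < e / 2.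
  exists (2 * (8 / e)); first by rewrite mulr_gt0// divr_gt0.
  rewrite mulrAC divff// mul1r.
  apply: (@le_lt_trans _ _ (2 * (1`!%:R / (8 / e) ^+ 1))).
    by rewrite ler_wpM2l//; apply: (@expRN_le _ _ 0); rewrite divr_gt0.
  by rewrite (_ : 1`! = 1%N)// expr1 invf_div mul1r; lra.
pose K := enorm (f u0) + L * sup_dist u (cpath_cst u0) tau.
have K0 : 0 <= K by rewrite addr_ge0 ?mulr_ge0 ?enorm_ge0 ?sup_dist_ge0.
have fK t : 0 <= t <= tau -> enorm (f (u t)) <= K.
  move=> ttau; rewrite -[f (u t)](subrK (f u0)) addrC.
  apply: le_trans (enormD _ _) _; rewrite lerD2l.
  apply: le_trans (fL _ _) _; rewrite ler_wpM2l//.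
  exact: (@sup_dist_ub _ _ u (cpath_cst u0)).
(* The + 1 only keeps the denominator of delta positive. *)
pose C0 := K * expR (L * tau) + 1.
have C0_gt0 : 0 < C0 by rewrite ltr_wpDl ?mulr_ge0 ?expR_ge0.
pose delta := e / 2 / C0.
have delta0 : 0 < delta by rewrite !divr_gt0.
pose C := 6 * (tau + 1) ^+ 2 / delta ^+ 3 + 2 / (tau * expR (- 1) ^+ 2).
have C_gt0 : 0 < C.
  apply: addr_gt0; last by rewrite divr_gt0// mulr_gt0// exprn_gt0// expR_gt0.
  by rewrite divr_gt0 ?exprn_gt0// mulr_gt0// exprn_gt0// addr_gt0.
near=> h.
have h0 : 0 < h by near: h; exact: nbhs_right_gt.
have h1 : h <= 1 by near: h; exact: nbhs_right_le.
have hC : h <= eta / C by near: h; apply: nbhs_right_le; rewrite divr_gt0.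
pose m := (Num.truncn (tau / h)).+1.
exists (irregular (H h) delta h m); split.
- exact: measurable_irregular.
- apply: le_trans (prob_irregular (hH h h0) m delta0 h0) _.
  rewrite lee_fin (le_trans (irregular_bound_le _ _ _))// ?h0//.
  by rewrite -/C mulrC -ler_pdivlMr.
apply: filterS (hV h h0) => w Vw reg; apply: eU.
rewrite ballEmdist/= -[mdist _ _]/(cpath_dist u (V h w)).
rewrite cpath_dist_sym.
have [u_0 du] := hu.
suff supV : sup_dist (V h w : cpath R d) u tau <= e / 2.
  by apply: le_lt_trans (cpath_dist_le supV) _; rewrite [ltRHS]splitr ltrD2l.
have tauT : tau <= jump_time (H h) (m * m)%N w.
  apply: le_trans (regular_jump_time (ltW h0) reg).
  by rewrite -ler_pdivrMr// ltW// truncnS_gt.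
apply: sup_dist_le => [|t /andP[t0 ttau]]; first by rewrite divr_ge0 ?ltW.
have err : enorm ((V h w : cpath R d) t - u t) + K * delta <=
    K * delta * expR (L * t).
  have T0 : jump_time (H h) 0 w = 0 by rewrite /jump_time big_ord0.
  apply: (@euler_error R d f u0 _ _ _ T0 Vw u L K delta tau (m * m)%N _ _ u_0 du
    L_ge0 fL fK K0 _ (m * m)%N (leqnn _) t) => //.
  - exact: cpath_continuous.
  - exact: cpath_continuous.
  - move=> k kmm; rewrite /jump_time big_ord_recr/= [_ + _ - _]addrAC subrr add0r.
    exact: regular_gap reg kmm.
  - by rewrite t0 (le_trans ttau).
apply: (@le_trans _ _ (K * delta * expR (L * t))).
  by apply: le_trans err; rewrite lerDl mulr_ge0// ltW.
apply: (@le_trans _ _ (K * expR (L * tau) * delta)).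
  rewrite mulrAC ler_wpM2r ?(ltW delta0)// ler_wpM2l// ler_expR.
  by rewrite ler_wpM2l.
rewrite /delta mulrCA ler_piMr ?divr_ge0 ?(ltW e0)//.
by rewrite ler_pdivrMr// mul1r /C0 lerDl.
Unshelve. all: by end_near. Qed.
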